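(* Let $G=(V_1,E_1)$ be a connected graph with $|V_1|\ge 2$ and let $H=(V_2,E_2)$ be a graph with $|V_2|\ge1$ and adjacency matrix $A_H$. Define $\psi_H(\lambda)=\dfrac{\lambda}{1+\lambda\langle\mathbf 1,(A_H+2+\lambda)^{-1}\mathbf 1\rangle}$, and let $\psi_H^{-1}(\mathrm{QEC}(G))$ denote the largest real solution $\lambda$ of $\psi_H(\lambda)=\mathrm{QEC}(G)$. Assume $-2-\psi_H^{-1}(\mathrm{QEC}(G))\notin\mathrm{ev}(A_H)$. Then $$\mathrm{QEC}(G\odot H)=\max\{\psi_H^{-1}(\mathrm{QEC}(G)),\gamma_2,\gamma_3\},$$ where $\gamma_2=0$ if $\mathrm{QEC}(G)=0$ or $-2\in\mathrm{ev}(A_H)$, and $\gamma_2=-\infty$ otherwise; and $\gamma_3=\max\{\lambda\in\mathbb R: \exists\, x\ne0,\ (A_H+2+\lambda)x=0,\ \langle\mathbf 1,x\rangle=0\}$, with $\gamma_3=-\infty$ if this set is empty.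
   Context: All graphs are finite, simple, undirected. The corona graph $G\odot H$ is obtained by taking one copy of $G$ and $|V_1|$ disjoint copies of $H$, and joining the $i$-th vertex of $G$ to every vertex of the $i$-th copy of $H$. For a connected graph $X$ with vertex set $V$ and distance matrix $D_X$, $\mathrm{QEC}(X)=\max\{\langle f,D_Xf\rangle : f\in\mathbb R^V,\ \langle f,f\rangle=1,\ \langle\mathbf 1,f\rangle=0\}$, where $\mathbf 1$ is the all-ones vector. $\mathrm{ev}(A)$ is the set of eigenvalues of $A$; $A_H+c$ means $A_H+cI$. *)

(* Defs.v *)
From HB Require Import structures.
From mathcomp Require Import all_boot all_order all_algebra.
From mathcomp Require Import all_classical all_reals all_analysis.

Set Implicit Arguments.
Unset Strict Implicit.
Unset Printing Implicit Defensive.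

Import Order.TTheory GRing.Theory Num.Theory numFieldNormedType.Exports.

Local Open Scope classical_set_scope.
Local Open Scope ring_scope.

Record sgraph := SGraph {
  vertex :> finType;
  adj : rel vertex;
  adj_sym : symmetric adj;
  adj_irr : irreflexive adj
}.

Definition connected_graph (X : sgraph) := forall x y : X, connect (@adj X) x y.

Definition walk (X : sgraph) (n : nat) (x y : X) : bool :=
  [exists p : n.-tuple X, path (@adj X) x p && (last x p == y)].

(* The least length of a walk from x to y; two vertices of a connected graph  *)
(* are always joined by a walk of length < #|X|.                              *)
Definition gdist (X : sgraph) (x y : X) : nat :=
  find (fun n => walk n x y) (iota 0 #|X|).

Section Corona.
Variables G H : sgraph.

Definition corona_adj (a b : G + G * H) : bool :=
  match a, b with
  | inl x, inl y => adj x y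
  | inl x, inr (y, _) => x == y
  | inr (x, _), inl y => x == y
  | inr (x, u), inr (y, v) => (x == y) && adj u v
  end.

Lemma corona_adj_sym : symmetric corona_adj.
Proof.
case=> [x|[x u]] [y|[y v]] //=; rewrite ?[RHS]eq_sym //; first exact: adj_sym.
by rewrite (eq_sym y) (adj_sym v).
Qed.

Lemma corona_adj_irr : irreflexive corona_adj.
Proof. by case=> [x|[x u]] /=; rewrite adj_irr ?andbF. Qed.

Definition corona : sgraph := SGraph corona_adj_sym corona_adj_irr.

End Corona.

(* The greatest element of A, or x0 if there is none.                         *)
Definition maximum {d} {T : porderType d} (x0 : T) (A : set T) : T :=
  xget x0 [set m | A m /\ ubound A m].

Definition dotv {R : realType} {n : nat} (f g : 'cV[R]_n) : R :=
  (f^T *m g) 0 0.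

Definition ones {R : realType} {n : nat} : 'cV[R]_n := const_mx 1.

Section QEC.
Variable R : realType.

Definition adjmx (X : sgraph) : 'M[R]_#|X| :=
  \matrix_(i, j) (adj (enum_val i) (enum_val j))%:R.

Definition distmx (X : sgraph) : 'M[R]_#|X| :=
  \matrix_(i, j) (gdist (enum_val i) (enum_val j))%:R.

(* By compactness of the sphere the maximum exists as soon as 1 < #|X|.       *)
Definition QEC (X : sgraph) : R :=
  maximum 0 [set c | exists f : 'cV[R]_#|X|,
    [/\ dotv f f = 1, dotv ones f = 0 & c = dotv f (distmx X *m f)]].

(* Meaningful only where adjmx H + 2 + z is invertible and the denominator is *)
(* nonzero, i.e. for all but finitely many z.                                 *)
Definition psi (H : sgraph) (z : R) : R :=
  z / (1 + z * dotv ones (invmx (adjmx H + 2%:M + z%:M) *m ones)).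

(* psi is a rational function and is extended by continuity across its        *)
(* removable singularities: the value at x is the limit along the punctured   *)
(* neighbourhoods of x. Where adjmx H + 2 + x is invertible and the           *)
(* denominator is nonzero this says psi H x = c, and no pole of psi is a      *)
(* solution. If -2 - x is an eigenvalue of adjmx H, x may be a solution; in   *)
(* particular, if that eigenvalue has an eigenvector not orthogonal to ones,  *)
(* then the extended psi vanishes at x.                                       *)
Definition psi_solutions (H : sgraph) (c : R) : set R :=
  [set x | psi H z @[z --> x^'] --> c].

(* psi_solutions H c is finite and nonempty if 0 < #|H|.                      *)
Definition psi_inv (H : sgraph) (c : R) : R := maximum 0 (psi_solutions H c).

Definition gamma2 (G H : sgraph) : \bar R :=
  if (QEC G == 0) || eigenvalue (adjmx H) (- 2) then 0%E else -oo%E.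

(* The set is finite, so that the value is -oo exactly when it is empty.      *)
Definition gamma3 (H : sgraph) : \bar R :=
  maximum -oo%E [set l%:E | l in [set l : R | exists x : 'cV[R]_#|H|,
    [/\ x != 0, (adjmx H + 2%:M + l%:M) *m x = 0 & dotv ones x = 0]]].

End QEC.

(* Main.v *)
Require Import Defs.
From HB Require Import structures.
From mathcomp Require Import all_boot all_order all_algebra.
From mathcomp Require Import all_classical all_reals all_analysis.
From mathcomp Require Import ring lra.

(* Write q = QEC G, A = adjmx H, and let J be the all-ones matrix of size      *)
(* 1 + #|H|. For f on the corona with total mass 0, let s x be the mass of f   *)
(* on x together with its copy of H. Corona distances are those of G plus 1    *)
(* for each endpoint outside G, corrected inside each copy, whence             *)
(*   <f, D f> = <s, D_G s> - \sum_x <h_x, (A + 2) h_x>                         *)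
(* where h_x is f on the copy at x. Bounding <s, D_G s> by q |s|^2 decouples   *)
(* the copies, with equality at phi (x) k for a maximizer phi of G, so that    *)
(* QEC (corona G H) is the top eigenvalue mu of M = q J - (0 (+) (A + 2)).     *)
(* With C z = A + 2 + z, psi z = z det (C z) / det (C z + z 1 1^T), which      *)
(* identifies solutions of psi = q with eigenvalues of M, except where C is    *)
(* singular. If C mu is singular then its kernel contains a vector orthogonal  *)
(* to 1 (gamma3), or mu = 0 (gamma2), or q = 0 and mu is itself a solution,    *)
(* contrary to the hypothesis on psi_inv.                                      *)

Set Implicit Arguments.
Unset Strict Implicit.
Unset Printing Implicit Defensive.

Import Order.TTheory GRing.Theory Num.Theory numFieldNormedType.Exports.

Local Open Scope ring_scope.

(** The reduction to one copy is [corona_quad] and [QEC_corona]; the spectral half is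
    [corona_spectrum]. On a vector (g, h), with g the entry in G and h the part in a copy of H, the
    eigen-equation of M at x reads q (g + <1,h>) = x g and C x h = x g 1 ([corona_mx_eigenP]). If C
    x is invertible, eliminating h leaves psi x = q ([eigen_psi_solution]); every solution of psi x
    = q is in turn an eigenvalue ([psi_solution_eigen]). Kernel vectors of C x that are orthogonal
    to 1, or arbitrary ones if x = 0, extend to eigenvectors too, which bounds gamma3 and gamma2 by
    mu. *)

(** * Walks and graph distance *)

Section Distance.
Variable X : sgraph.
Implicit Types (x y : X) (n : nat).

Lemma walkP n x y :
  reflect (exists p : seq X, [/\ size p = n, path (@adj X) x p & last x p = y])
    (walk n x y).
Proof.
apply: (iffP existsP) => [[p /andP[pp /eqP pl]]|[p [ps pp pl]]].
  by exists p; rewrite size_tuple.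
by move/eqP: ps => ps; exists (Tuple ps) => /=; rewrite pp pl eqxx.
Qed.

(** The search in [gdist] covers only lengths below [#|X|]. A minimal n is in that range, since
    erasing the cycles of a longer walk would give one with fewer edges. *)
Lemma gdist_eq n x y :
  walk n x y -> (forall m, (m < n)%N -> ~~ walk m x y) -> gdist x y = n.
Proof.
move=> wn nw.
have n_lt : (n < #|X|)%N.
  have /walkP[p [ps pp pl]] := wn; rewrite ltnNge; apply/negP => le_n.
  move: pl; case/shortenP: pp => p' pp' up' sub pl.
  have p'_lt : (size p' < n)%N.
    apply: leq_trans le_n; rewrite -[(size p').+1]/(size (x :: p')).
    by rewrite -(card_uniqP up') max_card.
  by move: (nw _ p'_lt) => /walkP; apply; exists p'.
have has_w : has (fun m => walk m x y) (iota 0 #|X|).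
  by apply/hasP; exists n => //; rewrite mem_iota.
have := nth_find 0%N has_w; have := has_w; rewrite has_find size_iota.
rewrite -/(gdist x y) => lt_d; rewrite nth_iota // add0n => wd.
case: (ltngtP (gdist x y) n) => // [d_lt|n_lt_d].
  by move: (nw _ d_lt); rewrite wd.
by have := before_find 0%N n_lt_d; rewrite nth_iota // add0n wn.
Qed.

Lemma gdist_walk x y : connect (@adj X) x y -> walk (gdist x y) x y.
Proof.
move=> /connectP[p pp pl].
have exw : exists n, walk n x y by exists (size p); apply/walkP; exists p.
have wm := ex_minnP exw; case: wm => m wm minm.
rewrite (gdist_eq wm) // => k k_lt; apply/negP => /minm.
by rewrite leqNgt k_lt.
Qed.

Lemma gdist_le n x y : walk n x y -> (gdist x y <= n)%N.
Proof.
move=> wn; have exw : exists n, walk n x y by exists n.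
have wm := ex_minnP exw; case: wm => m wm minm.
rewrite (gdist_eq wm) ?minm // => k k_lt; apply/negP => /minm.
by rewrite leqNgt k_lt.
Qed.

Lemma gdistxx x : gdist x x = 0%N.
Proof. by apply/eqP; rewrite -leqn0; apply/gdist_le/walkP; exists [::]. Qed.

Lemma gdist_edge (x' x y : X) :
  connect (@adj X) x' y -> adj x x' -> (gdist x y <= (gdist x' y).+1)%N.
Proof.
move=> /gdist_walk/walkP[p [ps pp pl]] xx'; apply/gdist_le/walkP.
by exists (x' :: p); rewrite /= xx' pp ps.
Qed.

End Distance.

(** * Distances in the corona *)

Section CoronaDistance.
Variables G H : sgraph.
Hypothesis G_connected : connected_graph G.
Implicit Types (x y : G) (u v : H) (a b : corona G H).

Definition base a : G := match a with inl x => x | inr (x, _) => x end.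
Definition outer a : bool := if a is inr _ then true else false.

(* The first alternative allows for walks that stay in one copy of H.         *)
Lemma corona_walk_ge b (p : seq (corona G H)) a :
  path (@adj (corona G H)) a p -> last a p = b ->
  (base a = base b /\ outer a && outer b)
  \/ (gdist (base a) (base b) + outer a + outer b <= size p)%N.
Proof.
elim: p a => [|a' p IHp] a /=.
  by move=> _ ->; case: b => [x|[x u]] /=; [right; rewrite gdistxx|left].
move=> /andP[aa' pp] /(IHp _ pp) {IHp pp}.
case: a a' aa' => [x|[x u]] [x'|[x' u']] /=.
- move=> xx' [[]//|]; rewrite !addn0 => le_p; right.
  apply: leq_trans (_ : ((gdist x' (base b)).+1 + outer b <= _)%N).
    by rewrite leq_add2r gdist_edge.
  by rewrite addSn ltnS.
- move=> /eqP<- [[<- ->]|le_p]; right; first by rewrite gdistxx.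
  by rewrite addn0; apply: leq_trans (leqW le_p); rewrite leq_add2r leq_addr.
- move=> /eqP<- [[]//|]; rewrite !addn0 => le_p; right.
  by rewrite addn1 addSn ltnS.
- move=> /andP[/eqP<- _] [[-> ->]|le_p]; first by left.
  by right; apply: leqW.
Qed.

Lemma walk_corona x y n : walk n x y -> @walk (corona G H) n (inl x) (inl y).
Proof.
move=> /walkP[p [ps pp pl]]; apply/walkP.
exists (map inl p); rewrite size_map ps (last_map inl) pl; split=> //.
by elim: p x pp {ps pl} => //= z p IHp x /andP[-> /IHp].
Qed.

(** Descend to the base if needed, follow a shortest walk of [G], climb again. For two vertices of
    one copy this is the detour of length 2 through their base. *)
Lemma corona_walk_le a b :
  @walk (corona G H) (gdist (base a) (base b) + outer a + outer b) a b.
Proof.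
have /walk_corona/walkP[p [ps pp pl]] := gdist_walk (G_connected (base a) (base b)).
apply/walkP.
case: a ps pp pl => [x|[x u]]; case: b => [y|[y v]] /= ps pp pl.
- by exists p; rewrite ps !addn0.
- exists (rcons p (inr (y, v))); rewrite size_rcons ps addn0 addn1 last_rcons.
  by rewrite rcons_path pp pl /= eqxx.
- by exists (inl x :: p); rewrite /= ps addn0 addn1 eqxx.
- exists (inl x :: rcons p (inr (y, v))).
  by rewrite /= size_rcons ps !addn1 last_rcons rcons_path pp pl /= !eqxx.
Qed.

Lemma gdist_corona a b :
  ~~ [&& outer a, outer b & base a == base b] ->
  gdist a b = (gdist (base a) (base b) + outer a + outer b)%N.
Proof.
move=> nab; apply: gdist_eq; first exact: corona_walk_le.
move=> m m_lt; apply/walkP => -[p [ps pp pl]]; rewrite -{m}ps in m_lt.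
have [[bab oab]|] := corona_walk_ge pp pl; last by rewrite leqNgt m_lt.
by case/negP: nab; rewrite andbA oab bab eqxx.
Qed.

(** The base vertex caps distances inside a copy at 2, so the distance matrix there is 2 (J - I) - A
    with J all ones of size [#|H|]; this is where A + 2 comes from. *)
Lemma gdist_copy x u v :
  @gdist (corona G H) (inr (x, u)) (inr (x, v)) =
  if u == v then 0%N else if adj u v then 1%N else 2%N.
Proof.
case: eqVneq => [->|neq_uv]; first exact: gdistxx.
case: ifP => uv; apply: gdist_eq.
- apply/walkP; exists [:: inr (x, v)].
  by split=> //=; rewrite eqxx uv.
- case=> // _; apply/walkP => -[p [/size0nil -> _ /= [e]]].
  by rewrite e eqxx in neq_uv.
- by have := corona_walk_le (inr (x, u)) (inr (x, v)); rewrite /= gdistxx.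
- case=> [|[|//]] _; apply/walkP.
    by move=> -[p [/size0nil -> _ /= [e]]]; rewrite e eqxx in neq_uv.
  by move=> -[[|c [|d p]] [] //= _ + cE]; rewrite cE eqxx uv.
Qed.

End CoronaDistance.

(** * Maxima of quadratic forms on the unit sphere *)

Section Rayleigh.
Variable R : realType.

Section Dot.
Variable n : nat.
Implicit Types (f g h c : 'cV[R]_n) (B S : 'M[R]_n).

Lemma dotvE f g : dotv f g = \sum_i f i 0 * g i 0.
Proof. by rewrite /dotv mxE; apply: eq_bigr => i _; rewrite mxE. Qed.

Lemma dotvC f g : dotv f g = dotv g f.
Proof. by rewrite !dotvE; apply: eq_bigr => i _; rewrite mulrC. Qed.

Lemma dotvDr f g h : dotv f (g + h) = dotv f g + dotv f h.
Proof. by rewrite /dotv mulmxDr mxE. Qed.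

Lemma dotvDl f g h : dotv (f + g) h = dotv f h + dotv g h.
Proof. by rewrite ![dotv _ h]dotvC dotvDr. Qed.

Lemma dotvZr a f g : dotv f (a *: g) = a * dotv f g.
Proof. by rewrite /dotv -scalemxAr mxE. Qed.

Lemma dotvZl a f g : dotv (a *: f) g = a * dotv f g.
Proof. by rewrite ![dotv _ g]dotvC dotvZr. Qed.

Lemma dotvNr f g : dotv f (- g) = - dotv f g.
Proof. by rewrite -scaleN1r dotvZr mulN1r. Qed.

Lemma dotvBr f g h : dotv f (g - h) = dotv f g - dotv f h.
Proof. by rewrite dotvDr dotvNr. Qed.

Lemma dotv0r f : dotv f 0 = 0.
Proof. by rewrite -(scale0r 0) dotvZr mul0r. Qed.

Lemma dotv_mulmx B f g : dotv f (B *m g) = dotv (B^T *m f) g.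
Proof. by rewrite /dotv trmx_mul trmxK mulmxA. Qed.

Lemma dotv_ge0 f : 0 <= dotv f f.
Proof. by rewrite dotvE sumr_ge0 // => i _; rewrite -expr2 sqr_ge0. Qed.

Lemma dotv_eq0 f : dotv f f = 0 -> f = 0.
Proof.
rewrite dotvE => /eqP; rewrite psumr_eq0 => [/allP f0|i _]; last first.
  by rewrite -expr2 sqr_ge0.
apply/matrixP => i j; rewrite ord1 mxE; apply/eqP.
by have := f0 i (mem_index_enum i); rewrite /= mulf_eq0 orbb.
Qed.

Lemma dotv_gt0 f : f != 0 -> 0 < dotv f f.
Proof.
by move=> f0; rewrite lt_def dotv_ge0 andbT; apply: contra_neq f0 => /dotv_eq0.
Qed.

Lemma normalize_dotv f : f != 0 ->
  exists2 a : R, a != 0 & dotv (a *: f) (a *: f) = 1.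
Proof.
move=> /dotv_gt0 f_gt0; exists (Num.sqrt (dotv f f))^-1.
  by rewrite invr_eq0 gt_eqF ?sqrtr_gt0.
rewrite dotvZl dotvZr mulrA -invfM -expr2 sqr_sqrtr ?ltW // mulVf //.
by rewrite gt_eqF.
Qed.

Lemma dot_continuous B : continuous (fun v : 'rV[R]_n => dotv v^T (B *m v^T)).
Proof.
have -> : (fun v : 'rV[R]_n => dotv v^T (B *m v^T)) =
    (fun v => \sum_i v 0 i * \sum_j B i j * v 0 j).
  apply/funext => v; rewrite dotvE; apply: eq_bigr => i _; rewrite !mxE.
  by congr (_ * _); apply: eq_bigr => j _; rewrite mxE.
apply: continuous_big => [|i _]; first exact: add_continuous.
move=> v; apply: continuousM; first exact: coord_continuous.
apply: (@continuous_big _ _ _ 0); first exact: add_continuous.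
move=> j _ w; apply: continuousM; first exact: cst_continuous.
exact: coord_continuous.
Qed.

(** Compactness of the sphere cut by the condition on c. The choice c = [ones] serves [QEC]; c = 0
    leaves the whole sphere and serves [rayleigh_eigen]. *)
Lemma rayleigh_attained B c f0 : dotv f0 f0 = 1 -> dotv c f0 = 0 ->
  exists f, [/\ dotv f f = 1, dotv c f = 0 &
    forall g, dotv g g = 1 -> dotv c g = 0 ->
      dotv g (B *m g) <= dotv f (B *m f)].
Proof.
move=> f1 fc.
pose A := [set v : 'rV[R]_n | dotv v^T v^T = 1 /\ dotv c v^T = 0]%classic.
have cl1 : closed [set v : 'rV[R]_n | dotv v^T v^T = 1]%classic.
  have -> : [set v : 'rV[R]_n | dotv v^T v^T = 1]%classic =
      ((fun v : 'rV[R]_n => dotv v^T (1%:M *m v^T)) @^-1` [set x | x = 1])%classic.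
    by apply/seteqP; split=> v /=; rewrite mul1mx.
  by apply: preimage_closed; [move=> v _; exact: dot_continuous|exact: closed_eq].
have cl2 : closed [set v : 'rV[R]_n | dotv c v^T = 0]%classic.
  apply: (@preimage_closed _ _ (fun v : 'rV[R]_n => dotv c v^T) [set x | x = 0]%classic);
    last exact: closed_eq.
  move=> v _.
  have -> : (fun v : 'rV[R]_n => dotv c v^T) = (fun v => \sum_i c i 0 * v 0 i).
    by apply/funext => w; rewrite dotvE; apply: eq_bigr => i _; rewrite mxE.
  apply: (@continuous_big _ _ _ 0); first exact: add_continuous.
  move=> i _ w; apply: continuousM; first exact: cst_continuous.
  exact: coord_continuous.
have cA : compact A.
  have cbox := @rV_compact R n (fun=> `[-1, 1]%classic) (fun=> @segment_compact R _ _).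
  apply: subclosed_compact (closedI cl1 cl2) cbox _.
  move=> v [/= v1 _] i; rewrite in_itv /= -ler_norml -(@ler_pXn2r _ 2) ?nnegrE //.
  rewrite expr1n real_normK ?num_real // -v1 dotvE (bigD1 i) //= !mxE -expr2 lerDl.
  by rewrite sumr_ge0 // => j _; rewrite -expr2 sqr_ge0.
have A0 : (A !=set0)%classic by exists f0^T; rewrite /A /= !trmxK.
have [|v vA vmax] := @compact_EVT_max _ R
    (fun v : 'rV[R]_n => dotv v^T (B *m v^T)) A A0 cA.
  exact/continuous_subspaceT/dot_continuous.
move: vA; rewrite inE => -[v1 vc]; exists v^T; split=> // g g1 gc.
by have := vmax g^T; rewrite trmxK; apply; rewrite inE /A /= trmxK.
Qed.

Lemma rayleigh_le B c f g : dotv c f = 0 ->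
    (forall g, dotv g g = 1 -> dotv c g = 0 ->
      dotv g (B *m g) <= dotv f (B *m f)) ->
  dotv c g = 0 -> dotv g (B *m g) <= dotv f (B *m f) * dotv g g.
Proof.
move=> fc fmax gc; have [->|g0] := eqVneq g 0.
  by rewrite mulmx0 !dotv0r mulr0.
have [a a0 ga] := normalize_dotv g0.
have := fmax _ ga; rewrite dotvZr gc mulr0 => /(_ erefl).
rewrite -scalemxAr; move: ga; rewrite !dotvZl !dotvZr !mulrA => ga le_ag.
have aa_gt0 : 0 < a * a by rewrite -expr2 exprn_even_gt0.
by rewrite -(ler_pM2l aa_gt0) mulrCA ga mulr1.
Qed.

(** If y = S f were nonzero, a suitable step from f along - y would make the form negative. *)
Lemma psd_kernel S f : S^T = S -> (forall g, 0 <= dotv g (S *m g)) ->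
  dotv f (S *m f) = 0 -> S *m f = 0.
Proof.
move=> symS posS fSf; set y := S *m f; apply: dotv_eq0.
set d := dotv y y; pose c := dotv y (S *m y); have c0 : 0 <= c := posS y.
(* With d = t (c + 1), the form at f - t y is - 2 t d + t^2 c = - t^2 (c + 2), which forces t = 0.
   Adding 1 to c covers the case c = 0. *)
pose t := d / (c + 1).
have td : t * (c + 1) = d by rewrite /t divfK // gt_eqF // ltr_wpDl.
have := posS (f + (- t) *: y).
rewrite mulmxDr -scalemxAr !(dotvDl, dotvDr, dotvZl, dotvZr) fSf.
rewrite -/y dotv_mulmx symS -/y -/c -/d -td => h.
suff t0 : t = 0 by rewrite t0 mul0r.
have t2c : 0 <= t ^+ 2 * c by rewrite mulr_ge0 ?sqr_ge0.
by apply/eqP; rewrite -sqrf_eq0 eq_le sqr_ge0 andbT; clear -h t2c; nra.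
Qed.

(** At a maximizer f with value mu, the form of the positive semidefinite matrix mu I - B vanishes,
    so [psd_kernel] makes f an eigenvector. *)
Lemma rayleigh_eigen B : (0 < n)%N -> B^T = B ->
  exists mu f, [/\ dotv f f = 1, B *m f = mu *: f &
    forall g, dotv g (B *m g) <= mu * dotv g g].
Proof.
move=> n_gt0 symB; pose i0 := Ordinal n_gt0.
have [||f [f1 fc fmax]] := @rayleigh_attained B 0 (delta_mx i0 0).
- rewrite dotvE (bigD1 i0) //= big1 ?mxE ?eqxx ?mulr1 ?addr0 // => j nj.
  by rewrite mxE (negbTE nj) mul0r.
- by rewrite dotvC dotv0r.
have le_f g : dotv g (B *m g) <= dotv f (B *m f) * dotv g g.
  by apply: rayleigh_le fmax _ => //; rewrite dotvC dotv0r.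
exists (dotv f (B *m f)), f; split=> //; set mu := dotv f _ in le_f *.
apply/esym/eqP; rewrite -subr_eq0 -mul_scalar_mx -mulmxBl; apply/eqP/psd_kernel.
- by rewrite linearB /= tr_scalar_mx symB.
- by move=> g; rewrite mulmxBl mul_scalar_mx dotvBr dotvZr subr_ge0.
- by rewrite mulmxBl mul_scalar_mx dotvBr dotvZr f1 mulr1 subrr.
Qed.

End Dot.
End Rayleigh.

(** * Determinants and zeros of polynomials *)

Section RankOne.
Variables (K : comNzRingType) (n : nat).

(** Both products in [E] factor the bordered matrix with rows (1, - v^T) and (u, 1); their
    determinants are compared without inverting anything. *)
Lemma det_add_rank1 (u v : 'cV[K]_n) :
  \det (1%:M + u *m v^T) = 1 + (v^T *m u) 0 0.
Proof.
have E : block_mx 1%:M 0 u 1%:M *m block_mx 1%:M (- v^T) 0 (1%:M + u *m v^T) =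
    block_mx (1%:M + v^T *m u) (- v^T) 0 1%:M *m block_mx 1%:M 0 u 1%:M.
  rewrite !mulmx_block !mul1mx !mulmx1 !mul0mx !mulmx0 !addr0 !add0r mulNmx.
  by rewrite addrK mulmxN addrCA addNr addr0.
have := congr1 determinant E.
rewrite !det_mulmx !det_lblock !det_ublock !det1 !mul1r !mulr1 => ->.
by rewrite det_mx11 !mxE eqxx.
Qed.

End RankOne.

Lemma horner_char_poly (K : fieldType) n (B : 'M[K]_n) z :
  (char_poly B).[z] = \det (z%:M - B).
Proof.
rewrite /char_poly -/(horner_eval z _) -det_map_mx; congr determinant.
apply/matrixP => i j; rewrite !mxE /=.
by rewrite horner_evalE hornerD hornerN hornerMn hornerX hornerC.
Qed.

Lemma poly_dnbhs_neq0 (R : realType) (p : {poly R}) x : p != 0 ->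
  (\forall z \near x^', p.[z] != 0)%classic.
Proof.
move=> p0; have [m [q + pE]] := multiplicity_XsubC p x.
rewrite p0 /= /root => qx0.
have qn : (\forall z \near x^', q.[z] != 0)%classic.
  apply: nbhs_dnbhs.
  by have /cvgr_neq0 := @continuous_horner R q x; apply.
near=> z; rewrite pE hornerM horner_exp !hornerE mulf_neq0 ?expf_neq0 //.
  by near: z.
by rewrite subr_eq0; near: z; exact: nbhs_dnbhs_neq.
Unshelve. all: by end_near. Qed.

(** * The function psi as a quotient of polynomials *)

Section Psi.
Variables (R : realType) (H : sgraph).
Implicit Types (x z c : R).

Notation A := (adjmx R H).
Notation one := (@ones R #|H|).

Definition shifted z : 'M[R]_#|H| := A + 2%:M + z%:M.
Definition psi_num z : R := \det (shifted z).
(** By the rank-one formula this is [psi_num z] times the denominator of [psi], in a form that still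
    makes sense where [shifted z] is singular. *)
Definition psi_den z : R := \det (shifted z + z *: (one *m one^T)).

Lemma adjmx_sym : A^T = A.
Proof. by apply/matrixP => i j; rewrite !mxE adj_sym. Qed.

Lemma shifted_sym z : (shifted z)^T = shifted z.
Proof. by rewrite /shifted !linearD /= adjmx_sym !tr_scalar_mx. Qed.

Lemma psi_num_poly : exists2 p : {poly R}, p != 0 & psi_num = horner p.
Proof.
exists (char_poly (- (A + 2%:M))).
  exact/monic_neq0/char_poly_monic.
by apply/funext => z; rewrite horner_char_poly opprK addrC.
Qed.

Lemma mul_rank1 (f g h : 'cV[R]_#|H|) : f *m g^T *m h = dotv g h *: f.
Proof.
rewrite -mulmxA [g^T *m h]mx11_scalar -/(dotv g h).
by apply/matrixP => i j; rewrite !mxE big_ord1 !mxE !ord1 eqxx mulr1n mulrC.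
Qed.

(** With K = I + 1 1^T, whose determinant 1 + <1,1> is positive, the matrix is K (z + K^-1 (A + 2)),
    so its determinant is a nonzero multiple of a characteristic polynomial. *)
Lemma psi_den_poly : exists2 p : {poly R}, p != 0 & psi_den = horner p.
Proof.
pose K : 'M[R]_#|H| := 1%:M + one *m one^T.
have K_unit : K \in unitmx.
  rewrite unitmxE det_add_rank1 unitfE gt_eqF //.
  by rewrite ltr_wpDr // -/(dotv one one) dotv_ge0.
exists (\det K *: char_poly (- (invmx K *m (A + 2%:M)))).
  rewrite scaler_eq0 negb_or -unitfE -unitmxE K_unit.
  exact/monic_neq0/char_poly_monic.
apply/funext => z; rewrite hornerZ horner_char_poly opprK -det_mulmx.
rewrite mulmxDr mulmxA mulmxV // mul1mx mul_mx_scalar /psi_den /shifted.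
congr determinant.
by rewrite scalerDr scale_scalar_mx mulr1 [RHS]addrC addrA.
Qed.

Lemma psi_denE z : psi_num z != 0 ->
  psi_den z = psi_num z * (1 + z * dotv one (invmx (shifted z) *m one)).
Proof.
move=> z0; have uC : shifted z \in unitmx by rewrite unitmxE unitfE.
rewrite -dotvZr scalemxAr /dotv -det_add_rank1 -det_mulmx mulmxDr mulmx1.
by rewrite -mulmxA mulKVmx // -scalemxAl.
Qed.

(* Both sides are 0 where psi_den vanishes, as x / 0 = 0.                     *)
Lemma psiE z : psi_num z != 0 -> psi H z = z * psi_num z / psi_den z.
Proof.
by move=> z0; rewrite psi_denE // invfM mulrA mulfK.
Qed.

Lemma psi_num_continuous : continuous psi_num.
Proof. by have [p _ ->] := psi_num_poly; exact: continuous_horner. Qed.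

Lemma psi_den_continuous : continuous psi_den.
Proof. by have [p _ ->] := psi_den_poly; exact: continuous_horner. Qed.

Lemma near_psi_num x : (\forall z \near x^', psi_num z != 0)%classic.
Proof. by have [p p0 ->] := psi_num_poly; exact: poly_dnbhs_neq0. Qed.

Lemma near_psi_den x : (\forall z \near x^', psi_den z != 0)%classic.
Proof. by have [p p0 ->] := psi_den_poly; exact: poly_dnbhs_neq0. Qed.

Lemma psi_num_cvg x : (z * psi_num z @[z --> x^'] --> x * psi_num x)%classic.
Proof.
by apply: cvgM; [exact: nbhs_dnbhs|apply/continuous_withinNx/psi_num_continuous].
Qed.

(** Denominators are cleared on a punctured neighbourhood, where neither determinant vanishes,
    before passing to the limit; so x may be a point where [shifted x] is singular. *)
Lemma psi_solution_eq x c : psi_solutions H c x -> x * psi_num x = c * psi_den x.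
Proof.
rewrite /psi_solutions /= => psi_c.
have : (psi H z * psi_den z @[z --> x^'] --> c * psi_den x)%classic.
  by apply: cvgM => //; apply/continuous_withinNx/psi_den_continuous.
have /near_eq_cvg/cvg_trans/[apply] :
    {near x^', (fun z => psi H z * psi_den z) =1 (fun z => z * psi_num z)}%classic.
  near=> z; rewrite psiE ?divfK //; near: z; first exact: near_psi_den.
  exact: near_psi_num.
by move=> num_c; apply: cvg_unique num_c; [exact: norm_hausdorff|exact: psi_num_cvg].
Unshelve. all: by end_near. Qed.

(** The quotient is continuous at x once [psi_den x] is nonzero, even if [psi_num x] is 0; this
    reaches removable singularities. *)
Lemma psi_solution_of_eq x c :
  psi_den x != 0 -> x * psi_num x = c * psi_den x -> psi_solutions H c x.
Proof.
move=> den0 num_den; rewrite /psi_solutions /=.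
have : (z * psi_num z / psi_den z @[z --> x^'] --> x * psi_num x / psi_den x)%classic.
  apply: cvgM; first exact: psi_num_cvg.
  by apply: cvgV => //; apply/continuous_withinNx/psi_den_continuous.
rewrite num_den mulfK //; apply: cvg_trans; apply: near_eq_cvg.
by near=> z; rewrite psiE //; near: z; exact: near_psi_num.
Unshelve. all: by end_near. Qed.

End Psi.

(** * Maxima of sets of roots, and kernels *)

Section Maximum.
Context (d : Order.disp_t) (T : porderType d).
Implicit Types (m : T) (A : set T).

Lemma maximum_eq (x0 : T) A m : A m -> ubound A m -> maximum x0 A = m.
Proof.
move=> Am ubm; rewrite /maximum; case: xgetP => [y _ [Ay uby]|none].
  by apply/le_anti; rewrite ubm ?uby.
by case: (none m).
Qed.

Lemma maximum_ub (x0 : T) A m : (x0 <= m)%O -> ubound A m -> (maximum x0 A <= m)%O.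
Proof.
by move=> le0 ubm; rewrite /maximum; case: xgetP => [y _ [/ubm]|].
Qed.

End Maximum.

(** Induction on the size of p: x splits off a linear factor, and the other elements of A are roots
    of the cofactor. *)
Lemma root_subset_max (K : realFieldType) (p : {poly K}) (A : set K) x :
  p != 0 -> (forall y, A y -> root p y) -> A x -> exists m, A m /\ ubound A m.
Proof.
have [n] := ubnP (size p); elim: n p A x => // n IHn p A x szp p0 subA Ax.
have [r pE] := factor_theorem p x (subA x Ax).
have r0 : r != 0 by apply: contraNneq p0 => r0; rewrite pE r0 mul0r.
have [[y [Ay yx]]|none] := pselect (exists y, A y /\ y != x).
  have [|z|m [[Am mx] ubm]] :=
    IHn r [set y | A y /\ y != x]%classic y _ r0 _ (conj Ay yx).
  - by move: szp; rewrite pE size_Mmonic ?monicXsubC // size_XsubC addn2.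
  - by move=> [/subA + zx]; rewrite pE rootM root_XsubC (negbTE zx) orbF.
  exists (Num.max m x); split; first by case: leP.
  move=> z Az; rewrite le_max; have [->|zx] := eqVneq z x; first by rewrite lexx orbT.
  by rewrite ubm.
exists x; split=> // y Ay; have [->//|yx] := eqVneq y x.
by case: none; exists y.
Qed.

Lemma det0_ker (K : fieldType) n (S : 'M[K]_n) : \det S = 0 ->
  exists2 v : 'cV_n, v != 0 & S *m v = 0.
Proof.
rewrite -det_tr => /eqP/det0P[v v0 vS]; exists v^T.
  by rewrite -(inj_eq trmx_inj) trmxK trmx0.
by apply: trmx_inj; rewrite trmx_mul trmxK trmx0.
Qed.

(** * The corona matrix and its eigenvectors *)

Section CoronaMatrix.
Variables (R : realType) (H : sgraph) (q : R).
Implicit Types (x g : R) (h v : 'cV[R]_#|H|).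

Notation A := (adjmx R H).
Notation one := (@ones R #|H|).
Notation vec g h := (col_mx (g%:M : 'M[R]_1) h).

Definition corona_mx : 'M[R]_(1 + #|H|) :=
  q *: (ones *m ones^T) - block_mx 0 0 0 (A + 2%:M).

Lemma corona_mx_sym : corona_mx^T = corona_mx.
Proof.
rewrite /corona_mx linearB /= linearZ /= trmx_mul trmxK.
by rewrite tr_block_mx !trmx0 linearD /= adjmx_sym tr_scalar_mx.
Qed.

Lemma vecP (f : 'cV[R]_(1 + #|H|)) : exists g h, f = vec g h.
Proof.
by exists (usubmx f 0 0), (dsubmx f); rewrite -mx11_scalar vsubmxK.
Qed.

Lemma vec_eq0 g h : (vec g h == 0) = (g == 0) && (h == 0).
Proof.
rewrite col_mx_eq0; congr (_ && _); apply/eqP/eqP => [|->].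
  by move/matrixP/(_ 0 0); rewrite !mxE.
by apply/matrixP => i j; rewrite !mxE mul0rn.
Qed.

Lemma dotv_vec g h g' h' : dotv (vec g h) (vec g' h') = g * g' + dotv h h'.
Proof.
by rewrite /dotv tr_col_mx mul_row_col tr_scalar_mx -scalar_mxM !mxE eqxx.
Qed.

Lemma ones_vec : ones = vec (1 : R) one :> 'cV[R]_(1 + #|H|).
Proof.
rewrite /ones -col_mx_const; congr col_mx.
by apply/matrixP => i j; rewrite !mxE !ord1.
Qed.

Lemma corona_mxE g h :
  corona_mx *m vec g h =
    vec (q * (g + dotv one h)) (q * (g + dotv one h) *: one - (A + 2%:M) *m h).
Proof.
rewrite /corona_mx mulmxBl -scalemxAl.
have -> : (ones *m ones^T : 'M[R]_(1 + #|H|)) *m vec g h =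
    (g + dotv one h) *: ones.
  rewrite -mulmxA [_^T *m _]mx11_scalar -/(dotv _ _) ones_vec dotv_vec mul1r.
  by rewrite mul_mx_scalar.
rewrite mul_block_col !mul0mx !add0r ones_vec scalerA scale_col_mx.
rewrite opp_col_mx add_col_mx subr0 scale_scalar_mx mulr1.
by congr col_mx.
Qed.

Lemma corona_mx_quad g h :
  dotv (vec g h) (corona_mx *m vec g h) =
    q * (g + dotv one h) ^+ 2 - dotv h ((A + 2%:M) *m h).
Proof.
by rewrite corona_mxE dotv_vec dotvBr dotvZr [dotv h one]dotvC; ring.
Qed.

Lemma corona_mx_eigenP x g h :
  corona_mx *m vec g h = x *: vec g h <->
  q * (g + dotv one h) = x * g /\ shifted H x *m h = (x * g) *: one.
Proof.
rewrite corona_mxE scale_col_mx scale_scalar_mx /shifted [in X in _ <-> _ /\ X]mulmxDl.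
rewrite mul_scalar_mx; split=> [/eq_col_mx[/matrixP/(_ 0 0)]|[-> <-]].
  by rewrite !mxE !mulr1n => -> <-; rewrite addrC subrK.
by rewrite addrAC subrr add0r.
Qed.

(** Where C = [shifted H x] is invertible, the eigenvector is (1, x C^-1 1). Where C is singular,
    the cleared equation only says q * [psi_den H x] = 0, and the vanishing of either factor yields
    an eigenvector. *)
Lemma psi_solution_eigen x : psi_solutions H q x ->
  exists2 f : 'cV[R]_(1 + #|H|), f != 0 & corona_mx *m f = x *: f.
Proof.
move=> /psi_solution_eq num_den.
suff [g [h [gh0 [eq1 eq2]]]] : exists g h, [/\ ~~ ((g == 0) && (h == 0)),
    q * (g + dotv one h) = x * g & shifted H x *m h = (x * g) *: one].
  by exists (vec g h); rewrite ?vec_eq0 //; apply/corona_mx_eigenP.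
have [num0|num0] := eqVneq (psi_num H x) 0; last first.
  exists 1, (x *: (invmx (shifted H x) *m one)); split; first by rewrite oner_eq0.
    apply: (mulfI num0); rewrite dotvZr mulrCA -psi_denE // -num_den; ring.
  by rewrite -scalemxAr mulKVmx ?mulr1 // unitmxE unitfE.
have [u u0 Cu] := det0_ker num0.
move/eqP: num_den; rewrite num0 mulr0 eq_sym mulf_eq0 => /orP[/eqP q0|/eqP].
  exists 0, u; rewrite (negbTE u0) andbF q0 mul0r mulr0 scale0r; split=> //.
move=> /det0_ker[v v0]; rewrite mulmxDl -scalemxAl mul_rank1 scalerA => Cv.
(* Here C v = - x <1,v> 1. If the right side is 0, then v is in the kernel of C and the entry -
   <1,v> makes the total mass 0. *)
have [xv0|xv0] := eqVneq (x * dotv one v) 0.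
  exists (- dotv one v), v; rewrite (negbTE v0) andbF addNr mulr0 mulrN xv0 oppr0.
  by move: Cv; rewrite xv0 !scale0r addr0.
(* Otherwise, pairing with u, a kernel vector of the symmetric C, gives <1,u> = 0, so (0, u) is an
   eigenvector. *)
exists 0, u; rewrite (negbTE u0) andbF !mulr0 scale0r add0r; split=> //.
have := congr1 (dotv u) Cv; rewrite dotvDr dotv_mulmx shifted_sym Cu dotv0r dotvC dotv0r.
rewrite add0r dotvZr => /eqP; rewrite mulf_eq0 (negbTE xv0) dotvC /= => /eqP->.
by rewrite mulr0.
Qed.

End CoronaMatrix.

(** * The top eigenvalue compared with the solutions of psi *)

Section TopEigenvalue.
Variables (R : realType) (H : sgraph) (q : R).
Implicit Types (x g : R) (h v : 'cV[R]_#|H|).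

Notation A := (adjmx R H).
Notation one := (@ones R #|H|).
Notation vec g h := (col_mx (g%:M : 'M[R]_1) h).
Notation M := (corona_mx H q).

(** Invertibility of C = [shifted H x] gives h = x g C^-1 1. Hence g is nonzero and can be divided
    out of the first equation, which leaves the cleared equation for psi. *)
Lemma eigen_psi_solution x g h : psi_num H x != 0 -> vec g h != 0 ->
  M *m vec g h = x *: vec g h -> psi_solutions H q x.
Proof.
move=> num0 gh0 /corona_mx_eigenP[eq1 eq2].
have C_unit : shifted H x \in unitmx by rewrite unitmxE unitfE.
have hE : h = (x * g) *: (invmx (shifted H x) *m one).
  by rewrite scalemxAr -eq2 mulKmx.
have g0 : g != 0.
  apply: contraNneq gh0 => g0; rewrite vec_eq0 g0 eqxx /= hE g0.
  by rewrite mulr0 scale0r.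
have num_den : x * psi_num H x = q * psi_den H x.
  apply: (mulfI g0); rewrite psi_denE // mulrCA mulrA -eq1 {1}hE dotvZr; ring.
(* A zero of [psi_den] would force x = 0, but at 0 it equals [psi_num]. *)
apply: psi_solution_of_eq => //; apply: contraNneq (num0) => den0.
have /eqP := num_den; rewrite den0 mulr0 mulf_eq0 => /orP[/eqP x0|->//].
by move: den0; rewrite psi_denE // x0 mul0r addr0 mulr1 => ->.
Qed.

Lemma mulmx_shifted x v : shifted H x *m v = (A + 2%:M) *m v + x *: v.
Proof. by rewrite /shifted mulmxDl mul_scalar_mx. Qed.

Lemma eigenvalue_adjmx x : eigenvalue A (- 2 - x) = (psi_num H x == 0).
Proof.
apply/eigenvalueP/eqP => [[v vA v0]|/det0_ker[v v0 Cv]].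
  apply/eqP/det0P; exists v => //.
  rewrite /shifted !mulmxDr vA !mul_mx_scalar -!scalerDl.
  by rewrite (_ : _ + x = 0) ?scale0r //; ring.
exists v^T; last by rewrite -(inj_eq trmx_inj) trmxK trmx0.
apply: trmx_inj; rewrite trmx_mul trmxK adjmx_sym linearZ /= trmxK.
move: Cv; rewrite /shifted !mulmxDl !mul_scalar_mx -addrA -scalerDl => /eqP.
by rewrite addr_eq0 -scaleNr opprD => /eqP.
Qed.

(** Here - 2 - x is an eigenvalue of A with no nonzero eigenvector orthogonal to 1. Then [psi_num]
    vanishes at x while [psi_den] does not, so the extended psi takes the value 0 = q. *)
Lemma psi_solution_of_main x h : x != 0 -> q = 0 -> h != 0 -> shifted H x *m h = 0 ->
  (forall v, v != 0 -> shifted H x *m v = 0 -> dotv one v != 0) ->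
  psi_solutions H q x.
Proof.
move=> x0 q0 h0 Ch main.
have num0 : psi_num H x = 0.
  apply/eqP/det0P; exists h^T; first by rewrite -(inj_eq trmx_inj) trmxK trmx0.
  by apply: trmx_inj; rewrite trmx_mul trmxK shifted_sym trmx0.
apply: psi_solution_of_eq; last by rewrite num0 q0 mulr0 mul0r.
(* Pairing with h gives x <1,v> <1,h> = 0, hence <1,v> = 0 and C v = 0, against [main]. *)
apply/eqP => /det0_ker[v v0]; rewrite mulmxDl -scalemxAl mul_rank1 scalerA => Cv.
have xv0 : x * dotv one v = 0.
  have := congr1 (dotv h) Cv; rewrite dotvDr dotv_mulmx shifted_sym Ch.
  rewrite dotvC !dotv0r add0r dotvZr => /eqP.
  by rewrite mulf_eq0 [dotv h _]dotvC (negbTE (main h h0 Ch)) orbF => /eqP.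
move: Cv; rewrite xv0 scale0r addr0 => /(main v v0).
by move/eqP: xv0; rewrite mulf_eq0 (negbTE x0) /= => ->.
Qed.

(* The least eigenvalue of M is a solution: testing M on |k|, for k a top     *)
(* eigenvector of A, puts it below -2 minus the top eigenvalue of A, where    *)
(* shifted is invertible.                                                     *)
Lemma psi_solution_exists : (0 < #|H|)%N -> q < 0 -> exists x, psi_solutions H q x.
Proof.
move=> H_gt0 q_lt0.
have [||nu [f [f1 fE fmax]]] := @rayleigh_eigen R _ (- M).
- by rewrite add1n.
- by rewrite linearN /= corona_mx_sym.
have [al [k [k1 kE kmax]]] := rayleigh_eigen H_gt0 (adjmx_sym R H).
pose k' : 'cV[R]_#|H| := map_mx Num.norm k.
have k'1 : dotv k' k' = 1.
  rewrite -k1 !dotvE; apply: eq_bigr => i _.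
  by rewrite !mxE -normrM ger0_norm // -expr2 sqr_ge0.
(* The entries of A are nonnegative, so taking absolute values in k cannot lower the form. *)
have le_k' : al <= dotv k' (A *m k').
  rewrite -[al]mulr1 -k1 -dotvZr -kE !dotvE; apply: ler_sum => i _.
  rewrite !mxE; apply: le_trans (ler_norm _) _; rewrite normrM ler_wpM2l //.
  apply: le_trans (ler_norm_sum _ _ _) _; apply: ler_sum => j _.
  by rewrite !mxE normrM ger0_norm.
have one_k' : 0 < dotv one k'.
  rewrite lt_def dotvE sumr_ge0 ?andbT => [|i _]; last by rewrite !mxE mul1r.
  apply/negP; rewrite psumr_eq0 => [/allP k0|i _]; last by rewrite !mxE mul1r.
  have /eqP := k1; rewrite (_ : k = 0) ?dotv0r 1?eq_sym ?oner_eq0 //.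
  apply/matrixP => i j; rewrite !ord1 [RHS]mxE; apply/eqP.
  by have := k0 i (mem_index_enum i); rewrite /= !mxE mul1r normr_eq0.
have nu_gt : al + 2 < nu.
  (* Since nu bounds the form of - M, this test vector gives al + 2 - q <1,k'>^2 <= nu, and q <
     0. *)
  have := fmax (vec 0 k'); rewrite mulNmx dotvNr corona_mx_quad dotv_vec k'1.
  rewrite mul0r !add0r mulr1 mulmxDl mul_scalar_mx dotvDr dotvZr k'1 mulr1.
  have : q * dotv one k' ^+ 2 < 0 by rewrite pmulr_llt0 ?exprn_gt0.
  by move: le_k'; clear; lra.
exists (- nu); have [g [h fgh]] := vecP f.
have f0 : f != 0.
  by apply: contra_eq_neq f1 => ->; rewrite dotv0r eq_sym oner_neq0.
rewrite fgh in f0 fE; apply: (@eigen_psi_solution _ g h) => //; last first.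
  by rewrite scaleNr -fE mulNmx opprK.
apply/eqP => /det0_ker[v v0]; rewrite mulmx_shifted mulmxDl mul_scalar_mx => Cv.
have := congr1 (dotv v) Cv; rewrite !dotvDr !dotvZr dotv0r.
have := kmax v; have := dotv_gt0 v0; clear -nu_gt.
by move: (dotv v v) (dotv v _) => a b; nra.
Qed.

Hypothesis H_gt0 : (0 < #|H|)%N.

Variable mu : R.
Hypothesis mu_max : forall f, dotv f (M *m f) <= mu * dotv f f.

Lemma eigen_le x (f : 'cV[R]_(1 + #|H|)) : f != 0 -> M *m f = x *: f -> x <= mu.
Proof.
move=> f0 fE; have := mu_max f; rewrite fE dotvZr ler_pM2r //; exact: dotv_gt0.
Qed.

Lemma psi_solution_le x : psi_solutions H q x -> x <= mu.
Proof. by move=> /psi_solution_eigen[f f0 /eigen_le]; apply. Qed.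

(** With no solution, [psi_inv] defaults to 0 and 0 <= mu is needed: [psi_solution_exists] rules out
    q < 0, and the vector (1, 0) gives q <= mu. With a solution, the maximum exists because
    solutions are roots of [char_poly M]. *)
Lemma psi_inv_le : psi_inv H q <= mu.
Proof.
have [[x xq]|none] := pselect (exists x, psi_solutions H q x).
  have [||m [mq ubm]] := @root_subset_max _ (char_poly M) (psi_solutions H q) x _ _ xq.
  - exact/monic_neq0/char_poly_monic.
  - move=> y /psi_solution_eigen[f f0 fE]; rewrite -eigenvalue_root_char.
    apply/eigenvalueP; exists f^T; last by rewrite -(inj_eq trmx_inj) trmxK trmx0.
    by apply: trmx_inj; rewrite trmx_mul trmxK corona_mx_sym linearZ /= trmxK.
  by rewrite /psi_inv (maximum_eq _ mq ubm) psi_solution_le.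
apply: maximum_ub; last by move=> y yq; exact: psi_solution_le.
have q_ge0 : 0 <= q by rewrite leNgt; apply/negP => /(psi_solution_exists H_gt0).
apply: le_trans q_ge0 _; have := mu_max (vec 1 0).
by rewrite corona_mx_quad dotv_vec mulmx0 !dotv0r subr0 !addr0 expr1n !mulr1.
Qed.

End TopEigenvalue.

(** The upper bounds on the three terms come from eigenvectors. That one of them reaches [mu] is a
    case analysis on the kernel of [shifted H mu]. *)
Lemma corona_spectrum (R : realType) (G H : sgraph) (mu : R)
    (f : 'cV[R]_(1 + #|H|)) :
    (0 < #|H|)%N -> f != 0 -> corona_mx H (QEC R G) *m f = mu *: f ->
    (forall f, dotv f (corona_mx H (QEC R G) *m f) <= mu * dotv f f) ->
    ~~ eigenvalue (adjmx R H) (- 2 - psi_inv H (QEC R G)) ->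
  mu%:E = maxe (maxe (psi_inv H (QEC R G))%:E (gamma2 R G H)) (gamma3 R H).
Proof.
move=> H_gt0 f0 fE mu_max; have [g [h fgh]] := vecP f; rewrite {}fgh in f0 fE.
have := psi_inv_le H_gt0 mu_max; rewrite eigenvalue_adjmx /gamma2.
have := @psi_solution_of_main R H (QEC R G).
have := @eigen_psi_solution R H (QEC R G) _ g h.
have := psi_solution_le mu_max; have := eigen_le mu_max.
move: (QEC R G) fE mu_max => q fE mu_max eig_le sol_le eig_sol main_sol psi_le not_ev.
have psi_mu : psi_solutions H q mu -> psi_inv H q = mu.
  by move=> muq; apply: maximum_eq muq _ => y /sol_le.
(* The eigenvector is (- <1,v>, v) if x = 0, and (0, v) if v is orthogonal to 1. *)
have ker_eig x (v : 'cV[R]_#|H|) : v != 0 -> shifted H x *m v = 0 ->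
    (x = 0 \/ dotv ones v = 0) -> x <= mu.
  move=> v0 Cv xv; have Nv0 c : col_mx (c%:M : 'M[R]_1) v != 0.
    by rewrite vec_eq0 (negbTE v0) andbF.
  case: xv => [x0|v1].
    apply: (eig_le _ _ (Nv0 (- dotv ones v))); apply/corona_mx_eigenP.
    by rewrite Cv addNr x0 mulr0 !mul0r scale0r.
  apply: (eig_le _ _ (Nv0 0)); apply/corona_mx_eigenP.
  by rewrite Cv v1 addr0 !mulr0 scale0r.
have gamma2_le : ((if (q == 0%R) || eigenvalue (adjmx R H) (- 2)%R
    then 0 else -oo) <= mu%:E)%E.
  case: ifP => [/orP[/eqP q0|]|_]; rewrite ?leNye ?lee_fin //.
    have e0 : col_mx (1%:M : 'M[R]_1) (0 : 'cV[R]_#|H|) != 0.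
      by rewrite vec_eq0 oner_eq0.
    by apply: (eig_le _ _ e0); apply/corona_mx_eigenP; rewrite q0 !mul0r mulmx0 scale0r.
  rewrite -[X in eigenvalue _ X]subr0 eigenvalue_adjmx => /eqP/det0_ker[v v0 Cv].
  by apply: (ker_eig _ v) => //; left.
have gamma3_ub : ubound [set l%:E | l in [set l : R | exists x : 'cV[R]_#|H|,
    [/\ x != 0, (adjmx R H + 2%:M + l%:M) *m x = 0 & dotv ones x = 0]]]%classic mu%:E.
  by move=> _ [l [v [v0 Cv v1]] <-]; rewrite lee_fin; apply: (ker_eig _ v) => //; right.
have gamma3_le : (gamma3 R H <= mu%:E)%E by apply: maximum_ub; rewrite ?leNye.
apply/le_anti; rewrite !ge_max lee_fin psi_le gamma2_le gamma3_le !andbT.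
rewrite !le_max lee_fin.
have [num0|/eig_sol/(_ f0 fE)/psi_mu->] := eqVneq (psi_num H mu) 0; last by rewrite lexx.
have [[v [v0 Cv v1]]|none] := pselect (exists v : 'cV[R]_#|H|,
    [/\ v != 0, shifted H mu *m v = 0 & dotv ones v = 0]).
  rewrite /gamma3 (maximum_eq _ _ gamma3_ub) ?lexx ?orbT //.
  by exists mu => //; exists v.
have main v : v != 0 -> shifted H mu *m v = 0 -> dotv ones v != 0.
  by move=> v0 Cv; apply/eqP => v1; apply: none; exists v.
have [mu0|mu0] := eqVneq mu 0.
  rewrite -[X in eigenvalue _ X]subr0 eigenvalue_adjmx.
  by rewrite mu0 in num0 *; rewrite num0 eqxx orbT lexx orbT.
have [u u0 Cu] := det0_ker num0.
have /corona_mx_eigenP[eq1 eq2] := fE.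
(* The second equation paired with u leaves mu g <1,u> = 0. With g = 0, h becomes a kernel vector
   and the first equation reads q <1,h> = 0, whence q = 0. *)
have g0 : g = 0.
  have := congr1 (dotv u) eq2; rewrite dotv_mulmx shifted_sym Cu.
  rewrite dotvC dotv0r dotvZr [dotv u _]dotvC => /esym/eqP.
  by rewrite !mulf_eq0 (negbTE mu0) (negbTE (main u u0 Cu)) orbF => /eqP.
have h0 : h != 0 by move: f0; rewrite vec_eq0 g0 eqxx.
have Ch : shifted H mu *m h = 0 by rewrite eq2 g0 mulr0 scale0r.
have q0 : q = 0.
  move/eqP: eq1; rewrite g0 add0r mulr0 mulf_eq0 (negbTE (main h h0 Ch)) orbF.
  by move/eqP.
(* So [mu] is a solution and equals [psi_inv], although [shifted H mu] is singular: exactly what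
   [not_ev] excludes. *)
move: not_ev; rewrite (psi_mu (main_sol _ _ mu0 q0 h0 Ch main)) num0 eqxx //.
Qed.

(** * The quadratic form of the corona distance *)

Section VertexFunctions.
Variables (R : realType) (X : sgraph).
Implicit Types (F K : X -> R) (f : 'cV[R]_#|X|).

Definition fcol F : 'cV[R]_#|X| := \col_i F (enum_val i).

Lemma sum_enum_val F : \sum_(i < #|X|) F (enum_val i) = \sum_x F x.
Proof. by rewrite -big_enum_val; apply: eq_bigl. Qed.

Lemma fcolP f : exists F, f = fcol F.
Proof.
exists (fun x => f (enum_rank x) 0).
by apply/matrixP => i j; rewrite !mxE ord1 enum_valK.
Qed.

Lemma dotv_fcol F K : dotv (fcol F) (fcol K) = \sum_x F x * K x.
Proof.
rewrite dotvE -(sum_enum_val (fun x => F x * K x)).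
by apply: eq_bigr => i _; rewrite !mxE.
Qed.

Lemma ones_fcol : ones = fcol (fun=> 1).
Proof. by apply/matrixP => i j; rewrite !mxE. Qed.

Lemma distmx_fcol F :
  distmx R X *m fcol F = fcol (fun x => \sum_y (gdist x y)%:R * F y).
Proof.
apply/matrixP => i j; rewrite !mxE -sum_enum_val.
by apply: eq_bigr => k _; rewrite !mxE.
Qed.

Lemma adjmx2_fcol F : (adjmx R X + 2%:M) *m fcol F =
  fcol (fun u => \sum_v ((adj u v)%:R + 2 * (u == v)%:R) * F v).
Proof.
apply/matrixP => i j; rewrite !mxE -sum_enum_val.
by apply: eq_bigr => k _; rewrite !mxE (inj_eq enum_val_inj) mulr_natr.
Qed.

End VertexFunctions.

Section CoronaForm.
Variables (R : realType) (G H : sgraph).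
Hypothesis G_connected : connected_graph G.
Implicit Types (a b : corona G H) (F : corona G H -> R).

Lemma sum_corona F :
  \sum_a F a = \sum_x (F (inl x) + \sum_u F (inr (x, u))).
Proof.
rewrite big_sumType big_split /=; congr (_ + _).
by rewrite pair_bigA; apply: eq_bigr => -[x u].
Qed.

Definition mass F (x : G) : R := F (inl x) + \sum_u F (inr (x, u)).

(** The block matrix with A + 2 on each copy and 0 elsewhere: the excess of the base distance plus
    one per outer endpoint over the true distance. *)
Definition same_copy a b : R :=
  match a, b with
  | inr (x, u), inr (y, v) => (x == y)%:R * ((adj u v)%:R + 2 * (u == v)%:R)
  | _, _ => 0
  end.

Lemma gdist_coronaE a b : (gdist a b)%:R =
  (gdist (base a) (base b))%:R + (outer a)%:R + (outer b)%:R - same_copy a b.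
Proof.
case: (boolP [&& outer a, outer b & base a == base b]) => [/and3P[]|nab].
  case: a b => [//|[x u]] [//|[y v]] _ _ /= /eqP <-.
  rewrite gdist_copy // gdistxx eqxx; case: eqVneq => [->|_].
    by rewrite adj_irr /=; ring.
  by case: (adj u v) => /=; ring.
rewrite gdist_corona // !natrD.
suff -> : same_copy a b = 0 by rewrite subr0.
by case: a b nab => [x|[x u]] [y|[y v]] //= /negbTE ->; rewrite mul0r.
Qed.

Lemma sum_base F (K : G -> R) : \sum_a F a * K (base a) = \sum_x mass F x * K x.
Proof.
rewrite sum_corona; apply: eq_bigr => x _.
by rewrite /mass mulrDl mulr_suml.
Qed.

Lemma sum_same_copy F (x : G) (u : H) :
  \sum_b same_copy (inr (x, u)) b * F b =
  \sum_v ((adj u v)%:R + 2 * (u == v)%:R) * F (inr (x, v)).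
Proof.
rewrite sum_corona (bigD1 x) //= mul0r add0r [X in _ + X]big1 ?addr0 => [|y yx].
  by apply: eq_bigr => v _; rewrite eqxx mul1r.
rewrite mul0r add0r big1 // => v _.
by rewrite eq_sym (negbTE yx) !mul0r.
Qed.

(** In the distance formula, the terms [outer a] and [outer b] each depend on one endpoint, so they
    vanish against F of sum 0. The base distance sees only the masses, and [same_copy] splits over
    the copies. *)
Lemma corona_quad F : \sum_a F a = 0 ->
  dotv (fcol F) (distmx R (corona G H) *m fcol F) =
  dotv (fcol (mass F)) (distmx R G *m fcol (mass F)) -
  \sum_x dotv (fcol (fun u => F (inr (x, u))))
              ((adjmx R H + 2%:M) *m fcol (fun u => F (inr (x, u)))).
Proof.
move=> F0; rewrite !distmx_fcol !dotv_fcol.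
have row a : \sum_b (gdist a b)%:R * F b =
    \sum_y mass F y * (gdist (base a) y)%:R + \sum_b F b * (outer b)%:R
    - \sum_b same_copy a b * F b.
  (* The added sum is 0; it completes the summand to the full formula of [gdist_coronaE]. *)
  have -> : \sum_b F b * (outer b)%:R =
      \sum_b F b * (outer b)%:R + \sum_b (outer a)%:R * F b.
    by rewrite -mulr_sumr F0 mulr0 addr0.
  rewrite -sum_base -!big_split -sumrB /=; apply: eq_bigr => b _.
  by rewrite gdist_coronaE; ring.
under eq_bigr do rewrite row mulrBr mulrDr.
rewrite sumrB big_split /= -[\sum_i F i * \sum_b F b * _]mulr_suml F0 mul0r addr0.
rewrite (sum_base F (fun x => \sum_y mass F y * (gdist x y)%:R)).
congr (_ - _).
  apply: eq_bigr => x _; congr (_ * _); apply: eq_bigr => y _; exact: mulrC.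
rewrite sum_corona; apply: eq_bigr => x _.
rewrite [X in _ * X]big1 => [|b _]; last by rewrite mul0r.
rewrite mulr0 add0r adjmx2_fcol dotv_fcol; apply: eq_bigr => u _.
by rewrite sum_same_copy.
Qed.

End CoronaForm.

(** * Attainment of QEC, and its value on the corona *)

Section QECAttained.
Variables (R : realType) (X : sgraph).

Lemma QEC_eq f : dotv f f = 1 -> dotv ones f = 0 ->
    (forall g, dotv g g = 1 -> dotv ones g = 0 ->
      dotv g (distmx R X *m g) <= dotv f (distmx R X *m f)) ->
  QEC R X = dotv f (distmx R X *m f).
Proof.
move=> f1 f0 fmax; apply: maximum_eq; first by exists f.
by move=> _ [g [g1 g0 ->]]; apply: fmax.
Qed.

Lemma QEC_attained : (2 <= #|X|)%N -> exists f, [/\ dotv f f = 1, dotv ones f = 0,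
  QEC R X = dotv f (distmx R X *m f) &
  forall g, dotv ones g = 0 -> dotv g (distmx R X *m g) <= QEC R X * dotv g g].
Proof.
move=> X2; pose i0 := Ordinal (ltnW X2); pose i1 := Ordinal X2.
(* Two distinct vertices give a nonzero vector orthogonal to 1, so the constrained sphere is
   nonempty. *)
pose f : 'cV[R]_#|X| := delta_mx i0 0 - delta_mx i1 0.
have dot1 i : dotv ones (delta_mx i 0 : 'cV[R]_#|X|) = 1.
  rewrite dotvE (bigD1 i) //= big1 ?mxE ?eqxx ?mulr1 ?addr0 ?mxE // => j ji.
  by rewrite !mxE (negbTE ji) mulr0.
have f_neq0 : f != 0.
  apply/eqP => /matrixP/(_ i0 0); rewrite !mxE eqxx /= subr0 => /eqP.
  by rewrite oner_eq0.
have [c _ cf1] := normalize_dotv f_neq0.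
have [||k [k1 k0 kmax]] := @rayleigh_attained R _ (distmx R X) ones (c *: f) => //.
  by rewrite dotvZr dotvBr !dot1 subrr mulr0.
exists k; split=> //; first exact: QEC_eq.
by move=> g g0; rewrite (QEC_eq k1 k0 kmax); apply: rayleigh_le kmax g0.
Qed.

End QECAttained.

Section CoronaQEC.
Variables (R : realType) (G H : sgraph).
Hypotheses (G_connected : connected_graph G) (G_size : (2 <= #|G|)%N).

Lemma QEC_corona (mu : R) (k : 'cV[R]_(1 + #|H|)) :
    dotv k k = 1 -> corona_mx H (QEC R G) *m k = mu *: k ->
    (forall f, dotv f (corona_mx H (QEC R G) *m f) <= mu * dotv f f) ->
  QEC R (corona G H) = mu.
Proof.
move=> k1 kE mu_max; have [phi [phi1 phi0 qE q_max]] := QEC_attained R G_size.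
have le_mu F : \sum_a F a = 0 ->
    dotv (fcol F) (distmx R (corona G H) *m fcol F) <= mu * dotv (fcol F) (fcol F).
  move=> F0; rewrite corona_quad //.
  (* The masses sum to 0, so [q_max] applies to them; the resulting bound is a sum over single
     vertices, each controlled by [mu_max]. *)
  apply: (@le_trans _ _ (\sum_x (QEC R G * mass F x ^+ 2 -
    dotv (fcol (fun u => F (inr (x, u))))
      ((adjmx R H + 2%:M) *m fcol (fun u => F (inr (x, u))))))).
    rewrite sumrB lerB // -mulr_sumr.
    under eq_bigr do rewrite expr2.
    rewrite -(dotv_fcol (mass F)); apply: q_max.
    rewrite ones_fcol dotv_fcol; under eq_bigr do rewrite mul1r.
    by move: F0; rewrite sum_corona.
  rewrite dotv_fcol sum_corona mulr_sumr; apply: ler_sum => x _.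
  have := mu_max (col_mx (F (inl x))%:M (fcol (fun u => F (inr (x, u))))).
  rewrite corona_mx_quad dotv_vec dotv_fcol ones_fcol dotv_fcol.
  by under eq_bigr do rewrite mul1r.
have [g [h kgh]] := vecP k; have [u hE] := fcolP h; have [f phiE] := fcolP phi.
move: phi1 phi0 qE k1 kE; rewrite {}phiE {}kgh {}hE ones_fcol dotv_vec !dotv_fcol.
under [in X in _ -> X]eq_bigr do rewrite mul1r.
move=> f1 f0 qE k1 kE.
(* The masses of this product vector are s times the maximizer f of [G], so the bound through
   [QEC R G] becomes an equality and the form reduces to that of [corona_mx] at k. *)
pose F (a : corona G H) : R :=
  match a with inl x => f x * g | inr (x, w) => f x * u w end.
pose s := g + \sum_w u w.
have massE x : mass F x = f x * s by rewrite /mass /s mulrDr mulr_sumr.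
have F0 : \sum_a F a = 0.
  rewrite sum_corona -[LHS]/(\sum_x mass F x); under eq_bigr do rewrite massE.
  by rewrite -mulr_suml f0 mul0r.
have F1 : dotv (fcol F) (fcol F) = 1.
  rewrite dotv_fcol sum_corona -[RHS]f1; apply: eq_bigr => x _ /=.
  rewrite -[RHS]mulr1 -k1 mulrDr mulr_sumr; congr (_ + _); first by ring.
  by apply: eq_bigr => w _; ring.
have fcolZ (X : sgraph) (c : R) (K : X -> R) : fcol (fun x => c * K x) = c *: fcol K.
  by apply/matrixP => i j; rewrite !mxE.
have FE : dotv (fcol F) (distmx R (corona G H) *m fcol F) = mu.
  rewrite corona_quad //.
  have -> : fcol (mass F) = s *: fcol f.
    by rewrite -fcolZ; congr fcol; apply/funext => x; rewrite massE mulrC.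
  rewrite -scalemxAr dotvZl dotvZr -qE.
  under eq_bigr do rewrite /F fcolZ -scalemxAr dotvZl dotvZr mulrA.
  rewrite -mulr_suml f1 mul1r mulrA mulrC mulrA.
  have := corona_mx_quad (QEC R G) g (fcol u).
  rewrite kE dotvZr dotv_vec dotv_fcol k1 mulr1 ones_fcol dotv_fcol.
  under eq_bigr do rewrite mul1r.
  by move=> ->; rewrite -/s expr2 mulrA.
rewrite -FE; apply: QEC_eq => // [|K K1].
  rewrite ones_fcol dotv_fcol -[RHS]F0; apply: eq_bigr => a _; exact: mul1r.
have [K' KE] := fcolP K; rewrite {}KE in K1 *.
rewrite ones_fcol dotv_fcol; under eq_bigr do rewrite mul1r.
by move=> /le_mu; rewrite K1 mulr1 FE.
Qed.

End CoronaQEC.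

Theorem theorem2 (R : realType) (G H : sgraph)
    (G_connected : connected_graph G) (G_size : (2 <= #|G|)%N)
    (H_size : (1 <= #|H|)%N)
    (not_ev : ~~ eigenvalue (adjmx R H) (- 2 - psi_inv H (QEC R G))) :
  (QEC R (corona G H))%:E =
    maxe (maxe (psi_inv H (QEC R G))%:E (gamma2 R G H)) (gamma3 R H).
Proof.
have [//||mu [k [k1 kE mu_max]]] := @rayleigh_eigen R _ (corona_mx H (QEC R G)).
  exact: corona_mx_sym.
rewrite (QEC_corona G_connected G_size k1 kE mu_max).
apply: corona_spectrum kE mu_max not_ev => //.
by apply: contra_eq_neq k1 => ->; rewrite dotv0r eq_sym oner_neq0.
Qed.
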